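(* Let $(x_n)_n$ be a frame for a Hilbert space $H$ with the canonical dual $(y_n)_n$. Suppose that a finite set of indices $E=\{n_1,n_2,\ldots,n_k\}$, $k\in\mathbb N$ (with $n_1,\ldots,n_k$ distinct), satisfies the minimal redundancy condition for $(x_n)_n$. Let $G\in M_k(\mathbb C)$ be the matrix whose $(i,j)$ entry is $\langle y_{n_j},x_{n_i}\rangle$, and let $I$ be the $k\times k$ unit matrix. For each index $n\notin E$ let $(\alpha_{n1},\alpha_{n2},\ldots,\alpha_{nk})$ be a (unique) solution of the linear system $$(G-I)\begin{bmatrix}\alpha_{n1}\\ \alpha_{n2}\\ \vdots\\ \alpha_{nk}\end{bmatrix}=\begin{bmatrix}\langle y_n,x_{n_1}\rangle\\ \langle y_n,x_{n_2}\rangle\\ \vdots\\ \langle y_n,x_{n_k}\rangle\end{bmatrix}.$$ Put $$v_{n_1}=v_{n_2}=\ldots=v_{n_k}=0,\qquad v_n=y_n-\sum_{i=1}^k\alpha_{ni}y_{n_i},\quad n\neq n_1,n_2,\ldots,n_k.$$ Then $(v_n)_n$ is a frame for $H$ dual to $(x_n)_n$.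
   Context: Convention: $H$ is a complex Hilbert space with inner product linear in the first argument; sequences $(x_n)_n$ are indexed by a set $J$, where either $J=\mathbb{N}=\{1,2,\ldots\}$ and $H$ is infinite-dimensional and separable, or $J=\{1,\ldots,M\}$ for some $M\in\mathbb N$ and $H$ is finite-dimensional. The sequence $(x_n)_n$ is a frame for $H$ if there are constants $A,B>0$ with $A\|x\|^2\le\sum_{n}|\langle x,x_n\rangle|^2\le B\|x\|^2$ for all $x\in H$. Its analysis operator is $U:H\to\ell^2(J)$, $Ux=(\langle x,x_n\rangle)_n$; the frame operator $U^*U$ is invertible, and the canonical dual is the frame $(y_n)_n$, $y_n=(U^*U)^{-1}x_n$. A frame $(v_n)_n$ for $H$ is dual to $(x_n)_n$ if $x=\sum_n\langle x,x_n\rangle v_n$ for all $x\in H$. A finite set of indices $E\subseteq J$ satisfies the minimal redundancy condition for $(x_n)_n$ if $\overline{\mathrm{span}}\{x_n: n\in J\setminus E\}=H$. *)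

(* Defs.v *)
From mathcomp Require Import all_boot all_order all_algebra.
From mathcomp Require Import complex.
From mathcomp Require Import all_classical all_reals all_analysis.

Set Implicit Arguments.
Unset Strict Implicit.
Unset Printing Implicit Defensive.

Import Order.TTheory GRing.Theory Num.Theory numFieldNormedType.Exports.
Local Open Scope classical_set_scope.
Local Open Scope complex_scope.
Local Open Scope ring_scope.

(* Over R[i] the library's norms take (real) values in R[i]; this is the
   squared norm as an element of R. *)
Definition sqnorm (R : realType) (V : normedZmodType R[i]) (u : V) : R :=
  complex.Re (`|u| ^+ 2).

(* The norm of the Banach space H is the one of the inner product dot, so that
   (H, dot) is a Hilbert space. A form {dot H for conj} is linear in its first
   argument. *)
Definition hilbert_dot (R : realType) (H : completeNormedModType R[i])
    (dot : {dot H for Num.conj}) : Prop :=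
  forall u : H, `|u| ^+ 2 = dot u u.

Definition lin_span (K : numFieldType) (V : lmodType K) (A : set V) : set V :=
  [set u | exists (m : nat) (c : 'I_m -> K) (w : 'I_m -> V),
     (forall i, A (w i)) /\ u = \sum_(i < m) c i *: w i].

Definition finite_dimensional (K : numFieldType) (V : lmodType K) : Prop :=
  exists s : seq V, lin_span [set` s] = setT.

Definition separable_space (T : topologicalType) : Prop :=
  exists D : set T, countable D /\ dense D.

(* Sequences are functions on nat of which only the values on J matter; indices
   start at 0 instead of 1, so {1, ..., M} becomes `I_M. *)
Definition index_set (R : realType) (H : completeNormedModType R[i])
    (J : set nat) : Prop :=
  (J = setT /\ ~ finite_dimensional H /\ separable_space H) \/
  (exists M : nat, (0 < M)%N /\ J = `I_M /\ finite_dimensional H).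

Section Frames.
Context (R : realType) (H : completeNormedModType R[i]).
Context (dot : {dot H for Num.conj}) (J : set nat).
Implicit Types (x v : nat -> H) (c d : nat -> R[i]).

Definition is_frame x : Prop :=
  exists A B : R, [/\ 0 < A, 0 < B & forall u : H,
    ((A * sqnorm u)%:E <= \sum_(n <oo | n \in J) (sqnorm (dot u (x n)))%:E)%E /\
    (\sum_(n <oo | n \in J) (sqnorm (dot u (x n)))%:E <= (B * sqnorm u)%:E)%E].

Definition analysis x (u : H) : nat -> R[i] := fun n => dot u (x n).

(* R[i]^o is R[i] with the topology given by its norm. *)
Definition l2dot c d : R[i] :=
  limn (fun N => \sum_(0 <= n < N | n \in J) c n * Num.conj (d n) : R[i]^o).

(* The adjoint U^* : l^2(J) -> H of the analysis operator U of x: U^* c is the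
   vector w such that <w, u> = <c, U u> for all u. *)
Definition analysis_adjoint x c : H :=
  xget 0 [set w | forall u : H, dot w u = l2dot c (analysis x u)].

Definition frame_operator x (u : H) : H := analysis_adjoint x (analysis x u).

(* 'pinv_(fun=> 0) setT S is the two-sided inverse of S when S is bijective. *)
Definition canonical_dual x : nat -> H :=
  fun n => 'pinv_(fun=> 0) setT (frame_operator x) (x n).

Definition is_dual_frame x v : Prop :=
  is_frame v /\
  forall u : H,
    (fun N => \sum_(0 <= n < N | n \in J) dot u (x n) *: v n) @ \oo --> u.

Definition minimal_redundancy x (E : set nat) : Prop :=
  closure (lin_span (x @` (J `\` E))) = setT.

End Frames.

(* Main.v *)
From HB Require Import structures.
Require Import Defs.
From mathcomp Require Import all_boot all_order all_algebra.
From mathcomp Require Import complex.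
From mathcomp Require Import all_classical all_reals all_analysis.
From mathcomp Require Import ring lra.
Import Order.TTheory GRing.Theory Num.Theory numFieldNormedType.Exports.
Local Open Scope classical_set_scope.
Local Open Scope complex_scope.
Local Open Scope ring_scope.

(* Let [S u = \sum_n <u, x_n> x_n] be the frame operator. It is coercive, hence
   bounded below, and Richardson iteration shows that it is onto; so
   [S y_n = x_n] and [u = \sum_n <u, x_n> y_n]. A fixed vector [a] of [G] gives
   [w = \sum_j a_j y_(n_j)] with [<w, x_(n_i)> = a_i], and comparing the two
   expressions of [<S w, w>] shows that [w] is orthogonal to [x_n] for [n] not in
   [E], so [w = 0] by minimal redundancy; hence [G - I] is invertible.
   With [M = (G - I)^-1] and [t_i = \sum_j conj(M_ij) x_(n_j)], one has
   [v_n = T y_n] for [n] not in [E], where [T z = z - \sum_i <z, t_i> y_(n_i)] is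
   a finite-rank perturbation of the identity. So [v] inherits an upper frame
   bound from [y], the finitely many terms in [E] account for exactly [u - T u]
   in [\sum_n <u, x_n> v_n = u], and duality provides the lower frame bound. *)

Set Implicit Arguments.
Unset Strict Implicit.
Unset Printing Implicit Defensive.

(** * Real-valued squared norms, and convergence expressed through them *)

Section ComplexNorm.
Context (R : realType).

Lemma sqnormE (V : normedZmodType R[i]) (u : V) : `|u| ^+ 2 = (sqnorm u)%:C.
Proof. by rewrite /sqnorm RRe_real// realX// normr_real. Qed.

Lemma sqnorm_ge0 (V : normedZmodType R[i]) (u : V) : 0 <= sqnorm u.
Proof. by rewrite -ler0c -sqnormE exprn_ge0. Qed.

Lemma sqnorm_eq0 (V : normedZmodType R[i]) (u : V) : sqnorm u = 0 -> u = 0.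
Proof.
move=> u0; apply/normr0_eq0/eqP.
have : `|u| ^+ 2 == 0 by rewrite sqnormE u0.
by rewrite expf_eq0.
Qed.

Lemma sqnorm0 (V : normedZmodType R[i]) : sqnorm (0 : V) = 0.
Proof. by rewrite /sqnorm normr0 expr0n. Qed.

Lemma sqnormN (V : normedZmodType R[i]) (u : V) : sqnorm (- u) = sqnorm u.
Proof. by rewrite /sqnorm normrN. Qed.

Lemma sqnormZ (V : normedModType R[i]) (c : R[i]) (u : V) :
  sqnorm (c *: u) = sqnorm c * sqnorm u.
Proof.
by apply: complexI; rewrite -sqnormE normrZ exprMn !sqnormE -rmorphM.
Qed.

Lemma sqnorm_lt (V : normedZmodType R[i]) (u : V) (r : R) :
  0 < r -> (sqnorm u < r ^+ 2) = (`|u| < r%:C).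
Proof.
move=> r0; rewrite -ltcR -sqnormE rmorphXn/=.
by rewrite ltr_pXn2r// nnegrE// ler0c ltW.
Qed.

Lemma sqnorm_complex (c : R[i]) :
  sqnorm c = complex.Re c ^+ 2 + complex.Im c ^+ 2.
Proof. by rewrite /sqnorm -add_Re2_Im2. Qed.

Lemma sqnorm_real (t : R) : sqnorm t%:C = t ^+ 2.
Proof. by rewrite sqnorm_complex/= expr0n addr0. Qed.

Lemma Re_realM (t : R) (c : R[i]) :
  complex.Re (t%:C * c) = t * complex.Re c.
Proof. by case: c => a b /=; rewrite mul0r subr0. Qed.

Lemma conj_conjc (c : R[i]) : Num.conj c = (c^*)%C.
Proof.
have [->|c0] := eqVneq c 0; first by rewrite rmorph0 conjc0.
by apply: (mulfI c0); rewrite -normCK sqr_normc.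
Qed.

Lemma sqnormJ (c : R[i]) : sqnorm (Num.conj c) = sqnorm c.
Proof. by rewrite /sqnorm norm_conjC. Qed.

(** Weighted arithmetic-geometric inequality: the gap is [t] times a sum of two squares. The free
    weight is later set to a frame bound or its inverse. *)
Lemma Re_mul_le (t : R) (c d : R[i]) : 0 < t ->
  2 * complex.Re (c * d) <= t * sqnorm c + t^-1 * sqnorm d.
Proof.
move=> t0; rewrite !sqnorm_complex; case: c d => a b [a' b'] /=.
have ti : t * t^-1 = 1 by rewrite divff// gt_eqF.
have t1 : 0 < t^-1 by rewrite invr_gt0.
rewrite -subr_ge0.
have -> : t * (a ^+ 2 + b ^+ 2) + t^-1 * (a' ^+ 2 + b' ^+ 2)
    - 2 * (a * a' - b * b')
  = t * ((a - t^-1 * a') ^+ 2 + (b + t^-1 * b') ^+ 2).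
  by field; rewrite gt_eqF.
by rewrite pmulr_rge0// addr_ge0// sqr_ge0.
Qed.

Lemma cvg_sqnormP (V : normedModType R[i]) (f : nat -> V) (l : V) :
  f @ \oo --> l <->
  forall eps : R, 0 < eps -> \forall n \near \oo, sqnorm (l - f n) < eps.
Proof.
split=> [fl eps eps0|fl].
  have e0 : 0 < Num.sqrt eps by rewrite sqrtr_gt0.
  move/cvgrPdist_lt : fl => /(_ (Num.sqrt eps)%:C); rewrite ltcR => /(_ e0).
  by apply: filterS => n; rewrite -sqnorm_lt// sqr_sqrtr// ltW.
apply/cvgrPdist_lt => e e0.
have eE : (complex.Re e)%:C = e by rewrite RRe_real// gtr0_real.
have r0 : 0 < complex.Re e by rewrite -ltcR eE.
have := fl _ (exprn_gt0 2 r0).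
by apply: filterS => n; rewrite sqnorm_lt// eE.
Qed.

Lemma cauchy_sqnorm_cvg (V : completeNormedModType R[i]) (f : nat -> V) :
  (forall eps : R, 0 < eps ->
    exists N, \forall n \near \oo, sqnorm (f N - f n) < eps) ->
  exists l : V, f @ \oo --> l.
Proof.
move=> fC; apply/cvg_ex.
apply/cauchy_cvgP/cauchy_exP => e e0.
have eE : (complex.Re e)%:C = e by rewrite RRe_real// gtr0_real.
have r0 : 0 < complex.Re e by rewrite -ltcR eE.
have [N fN] := fC _ (exprn_gt0 2 r0).
exists (f N); apply: filterS fN => n.
by rewrite sqnorm_lt// eE -ball_normE.
Qed.

End ComplexNorm.

(** * Hilbert-space identities and the Cauchy-Schwarz inequality *)

Section InnerProduct.
Context (R : realType) (H : completeNormedModType R[i]).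
Context (dot : {dot H for Num.conj}) (hdot : hilbert_dot dot).

Lemma dot_sqnorm (u : H) : dot u u = (sqnorm u)%:C.
Proof. by rewrite -hdot sqnormE. Qed.

Lemma dotC (u v : H) : dot u v = Num.conj (dot v u).
Proof. by have := hermC dot u v; rewrite expr0 mul1r. Qed.

Lemma ReJ (c : R[i]) : complex.Re (Num.conj c) = complex.Re c.
Proof. by rewrite conj_conjc; case: c. Qed.

Lemma sqnormD (u v : H) : sqnorm (u + v) =
  sqnorm u + sqnorm v + 2 * complex.Re (dot u v).
Proof.
apply: complexI; rewrite -dot_sqnorm dnormD !dot_sqnorm.
rewrite conj_conjc addcJ !(rmorphD, rmorphM)/=.
by [].
Qed.

Lemma sqnormB (u v : H) : sqnorm (u - v) =
  sqnorm u + sqnorm v - 2 * complex.Re (dot u v).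
Proof. by rewrite sqnormD sqnormN linearNr raddfN mulrN. Qed.

Lemma sqnormD_le (u v : H) : sqnorm (u + v) <= 2 * sqnorm u + 2 * sqnorm v.
Proof. have := sqnorm_ge0 (u - v); rewrite sqnormB sqnormD; lra. Qed.

Lemma Re_dot_le (t : R) (u v : H) : 0 < t ->
  2 * complex.Re (dot u v) <= t * sqnorm u + t^-1 * sqnorm v.
Proof.
move=> t0; have := sqnorm_ge0 (t%:C *: u - v).
rewrite sqnormB sqnormZ linearZl_LR/= Re_realM sqnorm_real.
have -> : t ^+ 2 * sqnorm u + sqnorm v - 2 * (t * complex.Re (dot u v)) =
  t * (t * sqnorm u + t^-1 * sqnorm v - 2 * complex.Re (dot u v)).
  by field; rewrite gt_eqF.
by rewrite pmulr_rge0// subr_ge0.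
Qed.

Lemma dot_CauchySchwarz (u v : H) :
  sqnorm (dot u v) <= sqnorm u * sqnorm v.
Proof.
have := sqnorm_ge0 u; rewrite le_eqVlt => /predU1P[/esym/sqnorm_eq0->|u0].
  by rewrite linear0l !sqnorm0 mul0r.
(* Scaling [u] by the conjugate of [dot u v] makes the inner product real and equal to
   [sqnorm (dot u v)]; the weight turns the first term on the right into that same quantity. *)
have := @Re_dot_le (sqnorm u)^-1 (Num.conj (dot u v) *: u) v.
rewrite invr_gt0 => /(_ u0); rewrite linearZl_LR/= [_^* * _]mulrC -normCK sqnormE/=.
rewrite sqnormZ sqnormJ invrK mulrCA mulVf ?gt_eqF// mulr1.
lra.
Qed.

Lemma cvg_dotl (f : nat -> H) (l u : H) : f @ \oo --> l ->
  (fun n => dot (f n) u : R[i]^o) @ \oo --> (dot l u : R[i]^o).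
Proof.
move=> /cvg_sqnormP fl; apply/cvg_sqnormP => eps eps0.
have u1 : 0 < 1 + sqnorm u by rewrite ltr_pwDl// sqnorm_ge0.
have := fl _ (divr_gt0 eps0 u1); apply: filterS => n.
rewrite ltr_pdivlMr// => /(le_lt_trans _); apply.
rewrite -linearBl/=; apply: (le_trans (dot_CauchySchwarz _ _)).
by rewrite ler_wpM2l ?sqnorm_ge0// lerDr.
Qed.

End InnerProduct.

(** * Continuity of the inner product and passage to the limit in norm bounds *)

Section Limits.
Context (R : realType) (H : completeNormedModType R[i]).
Context (dot : {dot H for Num.conj}) (hdot : hilbert_dot dot).
Implicit Types (f : nat -> H) (l u : H).

Lemma cvg_dotr f l u : f @ \oo --> l ->
  (fun n => dot u (f n) : R[i]^o) @ \oo --> (dot u l : R[i]^o).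
Proof.
move=> /(cvg_dotl hdot (u := u))/cvg_sqnormP fl; apply/cvg_sqnormP => eps /fl.
apply: filterS => n; rewrite (dotC dot u l) (dotC dot u (f n)) -rmorphB.
by rewrite sqnormJ.
Qed.

Lemma cvg_Re_dot f l u : f @ \oo --> l ->
  (fun n => complex.Re (dot (f n) u)) @ \oo --> complex.Re (dot l u).
Proof.
move=> /(cvg_dotl hdot (u := u))/cvg_sqnormP fl; apply/cvgrPdist_lt => eps eps0.
have := fl _ (exprn_gt0 2 eps0); apply: filterS => n.
rewrite sqnorm_complex => lt_eps.
rewrite -(ltr_pXn2r (_ : 0 < 2)%N) ?nnegrE ?(ltW eps0)// real_normK ?num_real//.
by rewrite -raddfB; apply: le_lt_trans lt_eps; rewrite lerDl sqr_ge0.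
Qed.

(** Pairing with the limit itself gives [2 Re <f n, l> <= c + sqnorm l], whose left side tends to
    [2 * sqnorm l]. *)
Lemma sqnorm_limit_le f l (c : R) : f @ \oo --> l ->
  (forall n, sqnorm (f n) <= c) -> sqnorm l <= c.
Proof.
move=> fl fc; have := cvg_Re_dot (u := l) fl.
rewrite (dot_sqnorm hdot)/= => /cvgr_to_le => /(_ ((c + sqnorm l) / 2)).
suff h : \forall n \near \oo, complex.Re (dot (f n) l) <= (c + sqnorm l) / 2.
  by move=> /(_ h); lra.
apply: nearW => n; have := Re_dot_le hdot (f n) l ltr01.
have := fc n; lra.
Qed.

Lemma cvg_sqnorm_le (V W : normedModType R[i]) (f : nat -> V) (g : nat -> W)
    (l : V) (l' : W) (c : R) :
  0 < c ->
  (\forall n \near \oo, sqnorm (l - f n) <= c * sqnorm (l' - g n)) ->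
  g @ \oo --> l' -> f @ \oo --> l.
Proof.
move=> c0 fg /cvg_sqnormP gl; apply/cvg_sqnormP => eps eps0.
have := gl _ (divr_gt0 eps0 c0); apply: filterS2 fg => n.
by rewrite ltr_pdivlMr// mulrC; apply: le_lt_trans.
Qed.

End Limits.

(** * Bessel sequences, the frame operator and the canonical dual *)

Section FrameOperator.
Context (R : realType) (H : completeNormedModType R[i]).
Context (dot : {dot H for Num.conj}) (hdot : hilbert_dot dot) (J : set nat).
Implicit Types (x v : nat -> H) (c : nat -> R[i]).

Definition energy x u N : R := \sum_(0 <= n < N | n \in J) sqnorm (dot u (x n)).

Definition synthesis x c N : H := \sum_(0 <= n < N | n \in J) c n *: x n.

Definition bessel x (B : R) := forall u N, energy x u N <= B * sqnorm u.

(** Trades the extended-real series for real partial sums: the lower frame bound becomes a statement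
    about every upper bound [b] of the partial energies. *)
Lemma is_frameP x : is_frame dot J x <-> exists A B : R,
  [/\ 0 < A, 0 < B, bessel x B &
    forall u b, (forall N, energy x u N <= b) -> A * sqnorm u <= b].
Proof.
have le_series u (b : R) :
    (\sum_(n <oo | n \in J) (sqnorm (dot u (x n)))%:E <= b%:E)%E <->
    forall N, energy x u N <= b.
  have ge0 n : (0 <= n)%N -> n \in J -> (0 <= (sqnorm (dot u (x n)))%:E)%E.
    by move=> _ _; rewrite lee_fin sqnorm_ge0.
  split=> [le_b N|le_b].
    rewrite -lee_fin -sumEFin; apply: le_trans le_b.
    exact: (nneseries_lim_ge N ge0).
  apply: lime_le; first exact: is_cvg_nneseries.
  by apply: nearW => N; rewrite sumEFin lee_fin; exact: le_b.
split=> [[A [B [A0 B0 AB]]]|[A [B [A0 B0 xB xA]]]].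
  exists A, B; split=> // [u|u b /le_series].
    by apply/le_series; have [] := AB u.
  by have [+ _] := AB u; rewrite -lee_fin; exact: le_trans.
exists A, B; split=> // u; split; last exact/le_series.
have : (\sum_(n <oo | n \in J) (sqnorm (dot u (x n)))%:E <=
    (B * sqnorm u)%:E)%E by exact/le_series.
(* The Bessel bound excludes the value [+oo], and nonnegativity of the terms excludes [-oo]. *)
case E : (\sum_(n <oo | n \in J) (sqnorm (dot u (x n)))%:E)%E => [b| |] //.
  by move=> _; rewrite lee_fin; apply: xA; apply/le_series; rewrite E.
move=> _; have : (0 <= \sum_(n <oo | n \in J) (sqnorm (dot u (x n)))%:E)%E.
  by apply: nneseries_ge0 => n _ _; rewrite lee_fin sqnorm_ge0.
by rewrite E.
Qed.

Lemma energy_homo x u : {homo energy x u : m n / (m <= n)%N >-> m <= n}.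
Proof.
move=> m n mn; rewrite /energy (big_cat_nat (leq0n m) mn)//= lerDl sumr_ge0// => i _.
exact: sqnorm_ge0.
Qed.

Section Bessel.
Context (x : nat -> H) (B : R) (B0 : 0 < B) (xB : bessel x B).
Local Notation S := (frame_operator dot J x).

(** Pair the sum [w] with itself and split each term with weight [B]: by the Bessel bound the terms
    in [dot w (x i)] add up to at most [sqnorm w], which is absorbed on the left. *)
Lemma bessel_sum_le c m n : sqnorm (\sum_(m <= i < n | i \in J) c i *: x i) <=
  B * \sum_(m <= i < n | i \in J) sqnorm (c i).
Proof.
set w := \sum_(_ <= _ < _ | _) _.
have : 2 * complex.Re (dot w w) <=
    \sum_(m <= i < n | i \in J) (B * sqnorm (c i) + B^-1 * sqnorm (dot w (x i))).
  rewrite {1}/w linear_sumlz raddf_sum/= mulr_sumr ler_sum// => i _.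
  rewrite linearZl_LR/= -(sqnormJ (dot w (x i))) -dotC.
  exact: Re_mul_le.
rewrite (dot_sqnorm hdot)/= big_split/= -!mulr_sumr.
have : B^-1 * \sum_(m <= i < n | i \in J) sqnorm (dot w (x i)) <= sqnorm w.
  rewrite mulrC ler_pdivrMr// mulrC; apply: le_trans (xB w n).
  have [mn|/ltnW nm] := leqP m n; last first.
    by rewrite big_geq// sumr_ge0// => i _; exact: sqnorm_ge0.
  rewrite /energy (big_cat_nat (leq0n m) mn)/= lerDr sumr_ge0// => i _.
  exact: sqnorm_ge0.
lra.
Qed.

(** The blocks of the synthesis series are dominated by blocks of the convergent energy series, so
    the partial sums are Cauchy; it remains to identify their limit with the adjoint. *)
Lemma frame_operator_cvg u :
  synthesis x (analysis dot x u) @ \oo --> S u.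
Proof.
have /cauchy_sqnorm_cvg [w Sw] : forall eps : R, 0 < eps -> exists N,
    \forall n \near \oo, sqnorm (synthesis x (analysis dot x u) N -
                                 synthesis x (analysis dot x u) n) < eps.
  move=> eps eps0.
  have cv : cvgn (energy x u).
    apply: nondecreasing_is_cvgn; first exact: energy_homo.
    by exists (B * sqnorm u) => _ [n _ <-]; exact: xB.
  have /cvgrPdist_lt/(_ _ (divr_gt0 eps0 B0))[N _ hN] := cv.
  exists N; exists N => // n /= Nn; rewrite -sqnormN opprB.
  rewrite {1}/synthesis (big_cat_nat (leq0n N) Nn)/= -/(synthesis x _ N) addrAC subrr add0r.
  apply: (le_lt_trans (bessel_sum_le _ _ _)).
  rewrite mulrC -ltr_pdivlMr//; apply: le_lt_trans (hN N (leqnn N)).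
  have := nondecreasing_cvgn_le (@energy_homo x u) cv n.
  rewrite {1}/energy (big_cat_nat (leq0n N) Nn)/= -/(energy x u N).
  by move=> le_lim; apply: le_trans (ler_norm _); rewrite lerBrDl.
(* The limit [w] satisfies the equation defining the adjoint, and a vector is determined by its
   inner products, so [xget] returns [w] and not its default 0. *)
suff -> : S u = w by [].
have wP (v : H) : dot w v = l2dot J (analysis dot x u) (analysis dot x v).
  apply/esym/cvg_lim; first exact: norm_hausdorff.
  under eq_fun do under eq_bigr do rewrite -dotC -linearZl_LR.
  under eq_fun do rewrite -linear_sumlz.
  exact: cvg_dotl.
apply: xget_unique => // w' w'P.
apply/eqP; rewrite -subr_eq0 -(dnorm_eq0 dot) linearBl/=.
by rewrite [dot w' _]w'P wP subrr.
Qed.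

Lemma dot_synthesis c u N : dot (synthesis x c N) u =
  \sum_(0 <= n < N | n \in J) c n * dot (x n) u.
Proof.
by rewrite linear_sumlz; apply: eq_bigr => n _; rewrite linearZl_LR.
Qed.

Lemma frame_operator_linear : linear S.
Proof.
move=> a u v; apply: (cvg_unique _ (frame_operator_cvg (u := a *: u + v))).
  exact: norm_hausdorff.
have -> : synthesis x (analysis dot x (a *: u + v)) = fun N =>
    a *: synthesis x (analysis dot x u) N + synthesis x (analysis dot x v) N.
  apply/funext => N; rewrite /synthesis scaler_sumr -big_split/=.
  apply: eq_bigr => n _; rewrite /analysis linearDl linearZl_LR/=.
  by rewrite scalerDl scalerA.
by apply: cvgD; [apply: cvgZr|]; exact: frame_operator_cvg.
Qed.

Lemma frame_operator0 : S 0 = 0.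
Proof.
by rewrite -[X in S X](subrr 0) -scaleN1r addrC frame_operator_linear scaleN1r addNr.
Qed.

Lemma frame_operator_sum (I : Type) (r : seq I) (P : pred I) (a : I -> R[i])
    (w : I -> H) :
  S (\sum_(i <- r | P i) a i *: w i) = \sum_(i <- r | P i) a i *: S (w i).
Proof.
elim: r => [|i r IH]; first by rewrite !big_nil frame_operator0.
by rewrite !big_cons; case: ifP => // _; rewrite frame_operator_linear IH.
Qed.

Lemma frame_operator_selfadjoint (u v : H) : dot (S u) v = dot u (S v).
Proof.
have h1 := cvg_dotl hdot (u := v) (frame_operator_cvg (u := u)).
have h2 := cvg_dotr hdot (u := u) (frame_operator_cvg (u := v)).
apply: (cvg_unique _ h1); first exact: norm_hausdorff.
rewrite (_ : (fun n => _) = fun n => dot u (synthesis x (analysis dot x v) n))//.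
apply/funext => N; rewrite [RHS]dotC !dot_synthesis rmorph_sum.
by apply: eq_bigr => n _; rewrite rmorphM/= -!dotC mulrC.
Qed.

Lemma Re_dot_synthesis u N :
  complex.Re (dot (synthesis x (analysis dot x u) N) u) = energy x u N.
Proof.
rewrite dot_synthesis raddf_sum; apply: eq_bigr => n _.
by rewrite [dot (x n) u]dotC -normCK.
Qed.

Lemma cvg_energy u : energy x u @ \oo --> complex.Re (dot (S u) u).
Proof.
have := cvg_Re_dot hdot (u := u) (frame_operator_cvg (u := u)).
by under eq_fun do rewrite Re_dot_synthesis.
Qed.

Lemma energy_le_dot u N : energy x u N <= complex.Re (dot (S u) u).
Proof.
have cv := cvg_energy (u := u).
rewrite -(cvg_lim (@Rhausdorff R) cv).
apply: nondecreasing_cvgn_le; first exact: energy_homo.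
by apply/cvg_ex; eexists; exact: cv.
Qed.

(** Operator form: [S^2 <= B S]. It is [bessel_sum_le] for the analysis coefficients, passed to the
    limit. *)
Lemma sqnorm_frame_operator_le u :
  sqnorm (S u) <= B * complex.Re (dot (S u) u).
Proof.
apply: (sqnorm_limit_le hdot (frame_operator_cvg (u := u))) => N.
apply: (le_trans (bessel_sum_le _ _ _)).
by rewrite ler_pM2l//; exact: energy_le_dot.
Qed.

Lemma frame_operator_bounded u : sqnorm (S u) <= B ^+ 2 * sqnorm u.
Proof.
have := Re_dot_le hdot (S u) u (t := B^-1); rewrite invr_gt0 invrK => /(_ B0).
rewrite -(ler_pM2l B0) mulrDr mulVKf ?gt_eqF// mulrA.
by have := sqnorm_frame_operator_le u; rewrite expr2; lra.
Qed.

End Bessel.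

(** * Inversion of the frame operator and reconstruction by the canonical dual *)

Section Frame.
Context (x : nat -> H) (A B : R) (A0 : 0 < A) (B0 : 0 < B).
Context (xB : bessel x B).
Context (xA : forall u b, (forall N, energy x u N <= b) -> A * sqnorm u <= b).
Local Notation S := (frame_operator dot J x).

Let SB (u v : H) : S (u - v) = S u - S v.
Proof.
rewrite -[- v]scaleN1r addrC (frame_operator_linear B0 xB) scaleN1r. exact: addrC.
Qed.

Lemma frame_operator_coercive u : A * sqnorm u <= complex.Re (dot (S u) u).
Proof. by apply: xA => N; exact: (energy_le_dot B0 xB). Qed.

Lemma frame_operator_bounded_below u : A ^+ 2 * sqnorm u <= sqnorm (S u).
Proof.
have := Re_dot_le hdot (S u) u (t := A^-1); rewrite invr_gt0 invrK => /(_ A0).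
rewrite -(ler_pM2l A0) mulrDr mulVKf ?gt_eqF// mulrA.
have := frame_operator_coercive u; rewrite -(ler_pM2l A0 (A * _)) expr2; lra.
Qed.

(** This step size gives both [lam * B <= 1] and the contraction factor [q = 1 - lam * A < 1]. *)
Let lam : R := (A + B)^-1.
Let q : R := B * lam.

(* Richardson iteration for [S u = w]. *)
Let richardson w u := u + lam%:C *: (w - S u).

(** The residual [r] becomes [r - lam S r]. In the expansion of its squared norm, [lam^2 |S r|^2] is
    at most [lam <S r, r>] since [lam * B <= 1]; coercivity bounds what is left by
    [(1 - lam * A) |r|^2]. *)
Let richardson_residual w u :
  sqnorm (w - S (richardson w u)) <= q * sqnorm (w - S u).
Proof.
have AB0 : 0 < A + B by rewrite addr_gt0.
have lam0 : 0 < lam by rewrite invr_gt0.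
have -> : w - S (richardson w u) = (w - S u) - lam%:C *: S (w - S u).
  rewrite /richardson [u + _]addrC (frame_operator_linear B0 xB).
  by rewrite [_ + S u]addrC opprD addrA.
set r := w - S u; rewrite (sqnormB hdot) sqnormZ sqnorm_real.
rewrite dotC ReJ (linearZl_LR dot)/= Re_realM.
have h1 := sqnorm_frame_operator_le B0 xB r.
have h2 := frame_operator_coercive r.
have lamE : lam * (A + B) = 1 by rewrite mulVf// gt_eqF.
have h3 : lam ^+ 2 * sqnorm (S r) <= lam * complex.Re (dot (S r) r).
  rewrite expr2 -mulrA ler_pM2l//.
  apply: (@le_trans _ _ (lam * (B * complex.Re (dot (S r) r)))).
    by rewrite ler_pM2l.
  rewrite mulrA ler_piMl//.
    by apply: le_trans h2; rewrite mulr_ge0// ?sqnorm_ge0// ltW.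
  by rewrite -lamE ler_pM2l// lerDr ltW.
have h4 : lam * (A * sqnorm r) <= lam * complex.Re (dot (S r) r).
  by rewrite ler_pM2l.
have -> : q * sqnorm r = sqnorm r - lam * (A * sqnorm r).
  have -> : q = 1 - lam * A by rewrite -lamE /q; ring.
  by ring.
lra.
Qed.

(** The residuals of the iterates decay geometrically, so their images under [S] converge to [w].
    The lower bound on [S] makes the iterates Cauchy, and boundedness of [S] shows that their limit
    is a solution. *)
Lemma frame_operator_surj w : exists u, S u = w.
Proof.
have AB0 : 0 < A + B by rewrite addr_gt0.
have lam0 : 0 < lam by rewrite invr_gt0.
have q0 : 0 <= q by rewrite mulr_ge0// ltW.
have q1 : q < 1 by rewrite /q ltr_pdivrMr// mul1r ltrDr.
pose f n := iter n (richardson w) 0.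
have res n : sqnorm (w - S (f n)) <= q ^+ n * sqnorm (w - S 0).
  elim: n => [|n IH]; first by rewrite expr0 mul1r.
  apply: (le_trans (richardson_residual _ _)).
  by rewrite exprS -mulrA ler_wpM2l.
have Sf : (S \o f) @ \oo --> w.
  apply/cvg_sqnormP => eps eps0.
  have := @cvg_geometric R (sqnorm (w - S 0)) q.
  rewrite ger0_norm// => /(_ q1)/cvgrPdist_lt/(_ _ eps0).
  apply: filterS => n /=; rewrite sub0r normrN ger0_norm; last first.
    by rewrite mulr_ge0 ?sqnorm_ge0// exprn_ge0.
  by rewrite mulrC; exact: le_lt_trans.
have A2 : 0 < A ^+ 2 by rewrite exprn_gt0.
have /cauchy_sqnorm_cvg[u fu] : forall eps : R, 0 < eps -> exists N,
    \forall n \near \oo, sqnorm (f N - f n) < eps.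
  (* Two residuals below this threshold, each doubled by [sqnormD_le], add up to less than
     [A ^+ 2 * eps]. *)
  move=> eps eps0; have e0 : 0 < A ^+ 2 * eps / 4.
    by rewrite divr_gt0// mulr_gt0.
  move/cvg_sqnormP : Sf => /(_ _ e0)[N _ hN].
  exists N; exists N => // n /= /hN/= hn.
  rewrite -(ltr_pM2l A2); apply: (le_lt_trans (frame_operator_bounded_below _)).
  have -> : S (f N - f n) = (w - S (f n)) - (w - S (f N)).
    by rewrite SB opprB [RHS]addrC addrA subrK.
  apply: (le_lt_trans (sqnormD_le hdot _ _)); rewrite sqnormN.
  by have := hN _ (leqnn N) => /=; lra.
exists u; apply: (cvg_unique _ _ Sf); first exact: norm_hausdorff.
apply: cvg_sqnorm_le fu; first exact: (exprn_gt0 2 B0).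
by apply: nearW => n /=; rewrite -SB; exact: frame_operator_bounded.
Qed.

Local Notation y := (canonical_dual dot J x).

Lemma canonical_dualK n : S (y n) = x n.
Proof.
apply: (@pinvK _ _ (fun=> 0) setT S); rewrite inE.
by have [u <-] := frame_operator_surj (x n); exists u.
Qed.

(** For [u = S z], self-adjointness gives [<u, y_n> = <z, x_n>], and [z] is controlled by [u]
    through the lower bound on [S]. *)
Lemma canonical_dual_bessel : bessel y (B / A ^+ 2).
Proof.
move=> u N; have [z zu] := frame_operator_surj u.
have -> : energy y u N = energy x z N.
  apply: eq_bigr => n _.
  by rewrite -zu (frame_operator_selfadjoint B0 xB) canonical_dualK.
apply: (le_trans (xB z N)); rewrite -mulrA ler_pM2l// mulrC ler_pdivlMr ?exprn_gt0//.
by rewrite mulrC -zu frame_operator_bounded_below.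
Qed.

(** Applying [S] to the error yields the error of the series for [S u]; the lower bound on [S]
    transfers its convergence back. *)
Lemma canonical_dual_reconstruction u :
  synthesis y (analysis dot x u) @ \oo --> u.
Proof.
have A2 : 0 < A ^+ 2 by rewrite exprn_gt0.
apply: (cvg_sqnorm_le (c := (A ^+ 2)^-1) _ _ (frame_operator_cvg B0 xB (u := u))).
  by rewrite invr_gt0.
apply: nearW => n; rewrite mulrC ler_pdivlMr// mulrC.
apply: (le_trans (frame_operator_bounded_below _)).
rewrite SB (_ : S (synthesis y _ n) = synthesis x (analysis dot x u) n)//.
rewrite (frame_operator_sum B0 xB); apply: eq_bigr => i _.
by rewrite canonical_dualK.
Qed.

End Frame.

(** Duality writes [|u|^2] as the limit of sums of [<u, x_n> <v_n, u>]. Splitting with weight [B^-1]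
    makes the [x] part at most [|u|^2], which leaves [|u|^2 <= B * b]. *)
Lemma dual_bessel_frame x v (B C : R) : 0 < B -> 0 < C ->
  bessel x B -> bessel v C ->
  (forall u, synthesis v (analysis dot x u) @ \oo --> u) -> is_dual_frame dot J x v.
Proof.
move=> B0 C0 xB vC dual; split=> //; apply/is_frameP.
exists B^-1, C; split=> //; first by rewrite invr_gt0.
move=> u b ub; rewrite mulrC ler_pdivrMr//.
have := cvg_Re_dot hdot (u := u) (dual u); rewrite (dot_sqnorm hdot)/=.
move=> /cvgr_to_le => /(_ ((sqnorm u + B * b) / 2)).
suff h : \forall n \near \oo, complex.Re (dot (synthesis v (analysis dot x u) n) u)
    <= (sqnorm u + B * b) / 2.
  by move=> /(_ h); lra.
apply: nearW => n; rewrite ler_pdivlMr// mulrC dot_synthesis raddf_sum mulr_sumr.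
apply: (@le_trans _ _ (B^-1 * energy x u n + B * energy v u n)).
  rewrite /energy !mulr_sumr -big_split ler_sum//= => i _.
  rewrite -(sqnormJ (dot u (v i))) -dotC.
  have := @Re_mul_le _ B^-1 (dot u (x i)) (dot (v i) u).
  by rewrite invr_gt0 invrK; exact.
apply: lerD; last by rewrite ler_pM2l.
by rewrite mulrC ler_pdivrMr// mulrC.
Qed.

End FrameOperator.

(** * Sums supported on a finite set of indices *)

Lemma big_range_support (V : nmodType) (k : nat) (e : 'I_k -> nat)
    (J : set nat) (f : nat -> V) (N : nat) :
  injective e -> (forall i, J (e i)) ->
  (forall n, (J `\` range e) n -> f n = 0) -> (forall i, (e i < N)%N) ->
  \sum_(0 <= n < N | n \in J) f n = \sum_i f (e i).
Proof.
move=> e_inj eJ f0 eN; rewrite big_mkcond/=.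
transitivity (\sum_(0 <= n < N) \sum_i (if n == e i then f (e i) else 0)).
  apply: eq_bigr => n _; have [[i _ <-]|nE] := pselect (range e n).
    rewrite -big_mkcond (big_pred1 i) ?mem_set// => j.
    by rewrite (inj_eq e_inj) eq_sym.
  rewrite big1 => [|i _]; last by case: eqP => // ne; case: nE; exists i.
  by case: ifPn => //; rewrite inE => nJ; apply: f0.
rewrite exchange_big/=; apply: eq_bigr => i _.
rewrite -big_mkcond big_mkord (big_pred1 (Ordinal (eN i)))// => n.
Qed.

Lemma near_range_lt (k : nat) (e : 'I_k -> nat) :
  \forall N \near \oo, forall i, (e i < N)%N.
Proof.
exists (\max_i e i).+1 => // N /= eN i.
by apply: leq_trans eN; rewrite ltnS; exact: leq_bigmax.
Qed.

(** * Finite-rank perturbations of the identity *)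

Section RankPerturbation.
Context (R : realType) (H : completeNormedModType R[i]).
Context (dot : {dot H for Num.conj}) (hdot : hilbert_dot dot).
Context (k : nat).
Implicit Types (s t : 'I_k -> H).

Definition perturb s t (z : H) : H := z - \sum_i dot z (t i) *: s i.

Lemma perturb_linear s t : linear (perturb s t).
Proof.
move=> a u z; rewrite /perturb scalerBr scaler_sumr addrACA -opprD -big_split/=.
congr (_ - _); apply: eq_bigr => i _.
by rewrite linearDl (linearZl_LR dot)/= scalerDl scalerA.
Qed.

HB.instance Definition _ s t :=
  GRing.isLinear.Build R[i] H H *:%R (perturb s t) (perturb_linear s t).

(** Swapping the two families gives the adjoint, which moves the perturbation from the frame vectors
    onto [u] in Bessel estimates. *)
Lemma dot_perturb s t u z : dot u (perturb s t z) = dot (perturb t s u) z.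
Proof.
rewrite /perturb linearBr linearBl linear_sumr linear_sumlz/=; congr (_ - _).
apply: eq_bigr => i _.
by rewrite (linearZr_LR dot) (linearZl_LR dot)/= (dotC dot z) conjCK mulrC.
Qed.

Lemma perturb_bounded s t :
  exists2 C : R, 0 < C & forall u, sqnorm (perturb s t u) <= C * sqnorm u.
Proof.
rewrite /perturb; elim: (index_enum _) => [|i r [C C0 Cs]].
  by exists 1 => // u; rewrite big_nil subr0 mul1r.
exists (2 * C + 2 * (sqnorm (t i) * sqnorm (s i))) => [|u].
  by rewrite ltr_pwDl ?mulr_gt0// !mulr_ge0 ?sqnorm_ge0.
rewrite big_cons opprD addrCA addrC.
apply: (le_trans (sqnormD_le hdot _ _)); rewrite [leRHS]mulrDl lerD//.
  by rewrite -mulrA ler_pM2l.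
rewrite sqnormN sqnormZ -mulrA ler_pM2l// mulrAC [sqnorm (t i) * _]mulrC.
by rewrite ler_wpM2r ?sqnorm_ge0// (dot_CauchySchwarz hdot).
Qed.

End RankPerturbation.

(** * Invertibility of [G - I] and the dual frame vanishing on the erased indices *)

Section ErasedFrame.
Context (R : realType) (H : completeNormedModType R[i]).
Context (dot : {dot H for Num.conj}) (hdot : hilbert_dot dot) (J : set nat).
Context (k : nat) (e : 'I_k -> nat).

Lemma nbhs_sqnorm (u : H) (eps : R) : 0 < eps ->
  nbhs u [set z | sqnorm (u - z) < eps].
Proof.
move=> eps0; have e0 : 0 < Num.sqrt eps by rewrite sqrtr_gt0.
apply/nbhs_ballP; exists (Num.sqrt eps)%:C => /=; first by rewrite ltcR.
move=> z; rewrite -ball_normE/= -sqnorm_lt// sqr_sqrtr//; exact: ltW.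
Qed.

Lemma minimal_redundancy_orthogonal (x : nat -> H) (w : H) :
  minimal_redundancy J x (range e) ->
  (forall n, (J `\` range e) n -> dot w (x n) = 0) -> w = 0.
Proof.
move=> red w0; apply: sqnorm_eq0; apply/eqP; rewrite eq_le sqnorm_ge0 andbT.
apply/ler_addgt0Pr => eps eps0; rewrite add0r.
have : closure (lin_span (x @` (J `\` range e))) w by rewrite red.
move=> /(_ _ (nbhs_sqnorm w eps0))[z [[m [c [y [yx ->]]]]]] /=.
move=> /ltW; apply: le_trans.
(* The approximant is orthogonal to [w], so by Pythagoras [sqnorm w] is at most the squared
   distance, hence at most [eps]. *)
rewrite (sqnormB hdot) linear_sumr [X in complex.Re X]big1 => [|i _].
  by rewrite mulr0 subr0 lerDl sqnorm_ge0.
have [n nJ <-] := yx i.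
by rewrite (linearZr_LR dot)/= w0// mulr0.
Qed.

Context (e_inj : injective e) (eJ : forall i, J (e i)).
Context (x : nat -> H) (A B : R) (A0 : 0 < A) (B0 : 0 < B).
Context (xB : bessel dot J x B).
Context (xA : forall u b,
  (forall N, energy dot J x u N <= b) -> A * sqnorm u <= b).
Context (red : minimal_redundancy J x (range e)).
Local Notation y := (canonical_dual dot J x).
Local Notation S := (frame_operator dot J x).
Local Notation G := (\matrix_(i, j) dot (y (e j)) (x (e i)) : 'M[R[i]]_k).

Lemma gram_sub1_inj (a : 'cV[R[i]]_k) : (G - 1%:M) *m a = 0 -> a = 0.
Proof.
move=> Ga; pose w := \sum_j a j 0 *: y (e j).
have wx i : dot w (x (e i)) = a i 0.
  rewrite linear_sumlz; have /matrixP/(_ i 0) : G *m a = a.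
    by apply/eqP; rewrite -subr_eq0 -{2}[a]mul1mx -mulmxBl Ga.
  rewrite mxE => <-; apply: eq_bigr => j _.
  by rewrite (linearZl_LR dot)/= mxE mulrC.
(* Since [S y_n = x_n], both sides are the sum of the [|a_i|^2]: all the energy of [w] sits on the
   erased indices. *)
have Sw : complex.Re (dot (S w) w) = \sum_i sqnorm (dot w (x (e i))).
  rewrite (frame_operator_sum hdot B0 xB) linear_sumlz raddf_sum.
  apply: eq_bigr => i _; rewrite (canonical_dualK hdot A0 B0 xB xA).
  by rewrite (linearZl_LR dot)/= wx (dotC dot _ w) wx -normCK.
have w0 : w = 0.
  apply: (minimal_redundancy_orthogonal red) => m [mJ mE].
  pose g n := if n \in range e then 0 else sqnorm (dot w (x n)).
  have g0 n : 0 <= g n by rewrite /g; case: ifP => // _; exact: sqnorm_ge0.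
  have [N _ eN] := near_range_lt e.
  (* The partial sum must contain every erased index and [m] itself; the upper limit is exclusive,
     hence [m.+1]. *)
  pose M := maxn N m.+1.
  have := energy_le_dot hdot B0 xB w M; rewrite Sw.
  have -> : energy dot J x w M = \sum_(0 <= n < M | n \in J) g n +
      \sum_i sqnorm (dot w (x (e i))).
    rewrite /energy.
    transitivity (\sum_(0 <= n < M | n \in J) (g n + (sqnorm (dot w (x n)) - g n))).
      by apply: eq_bigr => n _; rewrite addrC subrK.
    rewrite big_split/=; congr (_ + _).
    rewrite (big_range_support e_inj eJ) => [|n [_ nE]|i].
    - by apply: eq_bigr => i _; rewrite /g mem_set ?subr0//; exists i.
    - by rewrite /g memNset ?subrr.
    - by apply: eN => /=; exact: leq_maxl.
  rewrite gerDr => le0.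
  have : \sum_(0 <= n < M | n \in J) g n == 0 by rewrite eq_le le0 sumr_ge0.
  rewrite psumr_eq0// => /allP/(_ m).
  rewrite mem_index_iota/= leq_maxr => /(_ isT); rewrite mem_set//= /g memNset//.
  by move=> /eqP/sqnorm_eq0.
by apply/matrixP => i j; rewrite ord1 -wx w0 linear0l mxE.
Qed.

Lemma gram_sub1_unit : G - 1%:M \in unitmx.
Proof.
rewrite -unitmx_tr -row_free_unit -kermx_eq0; apply/rowV0P => r /sub_kermxP r0.
apply: trmx_inj; rewrite trmx0; apply: gram_sub1_inj.
by apply: trmx_inj; rewrite trmx_mul trmxK r0 trmx0.
Qed.

Local Notation M := (invmx (G - 1%:M)).
(** The coefficients are conjugated because [dot] is conjugate-linear in its second argument; thus
    [dot (y n) (t i)] is the [i]-th entry of the solution [alpha n]. *)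
Let t i : H := \sum_j Num.conj (M i j) *: x (e j).

Let dot_t z i : dot z (t i) = (M *m \col_j dot z (x (e j))) i 0.
Proof.
rewrite linear_sumr mxE; apply: eq_bigr => j _.
by rewrite (linearZr_LR dot)/= conjCK mxE.
Qed.

(** From [M (G - I) = I] follows [M G = I + M]; the identity part cancels [y (e j)] and leaves only
    the entries of [M]. *)
Let perturb_dual j :
  perturb dot (y \o e) t (y (e j)) = - \sum_i M i j *: y (e i).
Proof.
have MG : M *m G = 1%:M + M.
  rewrite -[X in M *m X](subrK 1%:M) mulmxDr mulmx1.
  by rewrite mulVmx ?gram_sub1_unit.
rewrite /perturb; have -> : \sum_i dot (y (e j)) (t i) *: (y \o e) i =
    \sum_i (i == j)%:R *: y (e i) + \sum_i M i j *: y (e i).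
  rewrite -big_split/=; apply: eq_bigr => i _; rewrite -scalerDl; congr (_ *: _).
  rewrite dot_t; have := congr1 (fun Z : 'M[R[i]]_k => Z i j) MG; rewrite !mxE => <-.
  by apply: eq_bigr => l _; rewrite !mxE.
rewrite (bigD1 j)//= eqxx scale1r big1 ?addr0 => [|i /negPf->]; last first.
  by rewrite scale0r.
by rewrite opprD addrA subrr add0r.
Qed.

Lemma erased_dual_frame (alpha : nat -> 'cV[R[i]]_k) (v : nat -> H) :
  (forall n, (J `\` range e) n ->
     (G - 1%:M) *m alpha n = \col_i dot (y n) (x (e i))) ->
  (forall i, v (e i) = 0) ->
  (forall n, (J `\` range e) n ->
     v n = y n - \sum_(i < k) alpha n i 0 *: y (e i)) ->
  is_dual_frame dot J x v.
Proof.
move=> alphaE ve vE.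
have vP n : (J `\` range e) n -> v n = perturb dot (y \o e) t (y n).
  move=> nE; rewrite vE//; congr (_ - _); apply: eq_bigr => i _.
  by rewrite dot_t -alphaE// mulKmx ?gram_sub1_unit.
have [C1 C10 C1P] := perturb_bounded hdot (y \o e) t.
have [C2 C20 C2P] := perturb_bounded hdot t (y \o e).
have By0 : 0 < B / A ^+ 2 by rewrite divr_gt0 ?exprn_gt0.
apply: (dual_bessel_frame hdot (C := B / A ^+ 2 * C2) B0 _ xB).
- by rewrite mulr_gt0.
(* This is the adjoint perturbation applied to [u]: off the erased indices [<u, v_n> = <u', y_n>],
   and on them [v] vanishes. *)
- move=> u N; set u' := perturb dot t (y \o e) u.
  apply: (@le_trans _ _ (energy dot J y u' N)).
    apply: ler_sum => n; rewrite inE => nJ.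
    have [[i _ <-]|nE] := pselect (range e n).
      by rewrite ve linear0r sqnorm0 sqnorm_ge0.
    by rewrite vP// dot_perturb.
  apply: le_trans (canonical_dual_bessel hdot A0 B0 xB xA u' N) _.
  by rewrite -[leRHS]mulrA ler_pM2l ?C2P.
move=> u; apply: cvg_sqnorm_le C10 _
  (canonical_dual_reconstruction hdot A0 B0 xB xA (u := u)).
apply: filterS (near_range_lt e) => N eN.
set c := analysis dot x u; set T := perturb dot (y \o e) t.
have Tsum : T (synthesis J y c N) = \sum_(0 <= n < N | n \in J) c n *: T (y n).
  by rewrite /T linear_sum; apply: eq_bigr => n _; rewrite linearZ.
(* Once [N] exceeds all erased indices, the error of [v] is the image under the bounded map [T] of
   the error of [y], so it tends to 0. *)
suff -> : u - synthesis J v c N = T (u - synthesis J y c N) by exact: C1P.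
have -> : synthesis J v c N = u - T u + T (synthesis J y c N).
  apply/eqP; rewrite -subr_eq Tsum /synthesis -sumrB; apply/eqP.
  under eq_bigr do rewrite -scalerBr.
  (* Off the erased indices [v n = T (y n)], so only erased terms survive; there [v] is 0 and
     [perturb_dual] expands [- T (y (e j))], which sums to [u - T u]. *)
  rewrite (big_range_support e_inj eJ) => [|n nE|//]; last first.
    by rewrite vP// subrr scaler0.
  have -> : u - T u = \sum_i dot u (t i) *: y (e i) by rewrite subKr.
  under eq_bigr do rewrite ve [T _]perturb_dual sub0r opprK scaler_sumr.
  rewrite exchange_big/=; apply: eq_bigr => i _.
  rewrite dot_t mxE scaler_suml; apply: eq_bigr => j _.
  by rewrite mxE scalerA mulrC.
by rewrite [RHS]linearB/= opprD addrA subKr.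
Qed.

End ErasedFrame.

Theorem theorem2p6 (R : realType) (H : completeNormedModType R[i])
    (dot : {dot H for Num.conj}) (J : set nat) (x y : nat -> H)
    (k : nat) (e : 'I_k -> nat) (G : 'M[R[i]]_k) (b : nat -> 'cV[R[i]]_k) :
  hilbert_dot dot ->
  index_set H J ->
  is_frame dot J x ->
  y = canonical_dual dot J x ->
  (0 < k)%N ->
  injective e ->
  (forall i, J (e i)) ->
  minimal_redundancy J x (range e) ->
  G = \matrix_(i, j) dot (y (e j)) (x (e i)) ->
  (forall n, b n = \col_i dot (y n) (x (e i))) ->
  (forall n, (J `\` range e) n ->
     exists! a : 'cV[R[i]]_k, (G - 1%:M) *m a = b n) /\
  (forall (alpha : nat -> 'cV[R[i]]_k) (v : nat -> H),
     (forall n, (J `\` range e) n -> (G - 1%:M) *m alpha n = b n) ->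
     (forall i, v (e i) = 0) ->
     (forall n, (J `\` range e) n ->
        v n = y n - \sum_(i < k) alpha n i 0 *: y (e i)) ->
     is_dual_frame dot J x v).
Proof.
move=> hdot _ /is_frameP[A [B [A0 B0 xB xA]]] -> _ e_inj eJ red -> bE.
have unitG := gram_sub1_unit hdot e_inj eJ A0 B0 xB xA red.
split=> [n _|alpha v alphaE ve vE].
  exists (invmx (\matrix_(i, j) dot (canonical_dual dot J x (e j)) (x (e i)) - 1%:M)
          *m b n).
  by split=> [|a <-]; rewrite ?mulKVmx ?mulKmx.
apply: (erased_dual_frame hdot e_inj eJ A0 B0 xB xA red _ ve vE) => n nE.
by rewrite -bE alphaE.
Qed.
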